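(* Let $(M,g,\nabla,\phi,\xi,\eta)$ be a $(\beta,\phi)$-Kenmotsu quadratic metric manifold. Then the quadratic structure $\phi$ is integrable, that is, its Nijenhuis tensor vanishes identically: $N_\phi\equiv0$.
   Context: An almost quadratic $\phi$-structure $(\phi,\eta,\xi)$ on a manifold $M$ consists of a $(1,1)$-tensor field $\phi$, a unit (in particular nowhere vanishing) vector field $\xi$ and a $1$-form $\eta$ with $\phi\xi=0$ and $\phi^2=a\phi+b(I-\eta\otimes\xi)$, where $a$ is an arbitrary real constant, $b$ is a nonzero real constant and $a^2+4b\neq0$ (one then has $\eta(\xi)=1$ and $\eta\circ\phi=0$). If $M$ has a Riemannian metric $g$ with $g(\phi X,Y)=g(X,\phi Y)$ for all $X,Y$ (compatibility, taken in the paper as equivalent to $g(\phi X,\phi Y)=a\,g(\phi X,Y)+b(g(X,Y)-\eta(X)\eta(Y))$), then $(g,\phi,\eta,\xi)$ is an almost quadratic metric $\phi$-structure and $M$ an almost quadratic metric $\phi$-manifold. An almost quadratic metric $\phi$-manifold $(M,g,\nabla,\phi,\xi,\eta)$, with $\nabla$ the Levi-Civita connection of $g$, is called a $(\beta,\phi)$-Kenmotsu quadratic metric manifold, $\beta\in C^\infty(M)$, if $(\nabla_X\phi)Y=\beta\{g(X,\phi Y)\xi+\eta(Y)\phi X\}$ for all vector fields $X,Y$ on $M$. The Nijenhuis tensor of a $(1,1)$-tensor field $K$ is $N_K(X,Y)=K^2[X,Y]+[KX,KY]-K[KX,Y]-K[X,KY]$. *)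

(* Defs.v *)
From HB Require Import structures.
From mathcomp Require Import all_boot all_order all_algebra.
From mathcomp Require Import all_classical all_reals all_analysis.
From mathcomp Require Import ring.

Set Implicit Arguments.
Unset Strict Implicit.
Unset Printing Implicit Defensive.

Import Order.TTheory GRing.Theory Num.Theory.
Import numFieldNormedType.Exports.

Local Open Scope classical_set_scope.
Local Open Scope ring_scope.

(* [Ck k U f]: all iterated partial derivatives of f of order at most k exist
   and are continuous on U.  It is only meant for open U; the values of f
   outside U are then irrelevant (lemma [Ck_ext]). *)
Fixpoint Ck (R : realType) (n k : nat) (U : set 'rV[R]_n) (f : 'rV[R]_n -> R)
    : Prop :=
  (forall x, U x -> {for x, continuous f}) /\
  match k with
  | 0 => True
  | k'.+1 => forall i : 'I_n,
      (forall x, U x -> derivable f x (delta_mx 0 i)) /\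
      Ck k' U (fun x => 'D_(delta_mx 0 i) f x)
  end.

Definition Cinfty_on (R : realType) (n : nat) (U : set 'rV[R]_n)
    (f : 'rV[R]_n -> R) : Prop :=
  forall k, Ck k U f.

Section CkTheory.
Context {R : realType} {n : nat}.
Implicit Types (U : set 'rV[R]_n) (f g : 'rV[R]_n -> R).

Lemma Ck_ext k U f g : open U -> (forall x, U x -> f x = g x) ->
  Ck k U f -> Ck k U g.
Proof.
move=> oU; elim: k f g => [|k IH] f g fg /= [cf df].
  split=> // x Ux; have nfg : {near x, f =1 g}.
    by near=> y; apply: fg; near: y; exact: open_nbhs_nbhs.
  rewrite /prop_for /continuous_at -(fg x Ux).
  exact: cvg_trans (near_eq_cvg nfg) (cf x Ux).
have nfg x : U x -> {near x, f =1 g}.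
  by move=> Ux; near=> y; apply: fg; near: y; exact: open_nbhs_nbhs.
split=> [x Ux|i].
  rewrite /prop_for /continuous_at -(fg x Ux).
  exact: cvg_trans (near_eq_cvg (nfg x Ux)) (cf x Ux).
have [dfi Cfi] := df i; split=> [x Ux|].
  exact: near_eq_derivable (nfg x Ux) (dfi x Ux).
apply: IH Cfi => x Ux; exact: near_eq_derive (nfg x Ux).
Unshelve. all: by end_near. Qed.

Lemma CkW k U f : Ck k.+1 U f -> Ck k U f.
Proof.
elim: k f => [|k IH] f [cf df]; first by split.
by split=> // i; have [? /IH] := df i.
Qed.

Lemma Ck_cst k U (a : R) : Ck k U (cst a).
Proof.
elim: k a => [|k IH] a /=; split=> //; try by move=> x _; exact: cst_continuous.
move=> i; split=> [x _|]; first exact: derivable_cst.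
rewrite (_ : (fun _ => _) = cst 0); first exact: IH.
by apply/funext => x; rewrite derive_cst.
Qed.

Lemma CkD k U f g : open U -> Ck k U f -> Ck k U g -> Ck k U (f + g).
Proof.
move=> oU; elim: k f g => [|k IH] f g /= [cf df] [cg dg].
  by split=> // x Ux; apply: continuousD; [exact: cf|exact: cg].
split=> [x Ux|i]; first by apply: continuousD; [exact: cf|exact: cg].
have [dfi Cfi] := df i; have [dgi Cgi] := dg i; split=> [x Ux|].
  by apply: derivableD; [exact: dfi|exact: dgi].
apply: Ck_ext (IH _ _ Cfi Cgi) => // x Ux.
by rewrite deriveD//; [exact: dfi|exact: dgi].
Qed.

Lemma CkM k U f g : open U -> Ck k U f -> Ck k U g -> Ck k U (f * g).
Proof.
move=> oU; elim: k f g => [|k IH] f g Cf Cg.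
  case: Cf Cg => cf _ [cg _].
  by split=> // x Ux; apply: continuousM; [exact: cf|exact: cg].
have [Cf' Cg'] := (CkW Cf, CkW Cg).
case: Cf Cg => cf df [cg dg].
split=> [x Ux|i]; first by apply: continuousM; [exact: cf|exact: cg].
have [dfi Cfi] := df i; have [dgi Cgi] := dg i; split=> [x Ux|].
  by apply: derivableM; [exact: dfi|exact: dgi].
apply: Ck_ext (CkD oU (IH _ _ Cf' Cgi) (IH _ _ Cg' Cfi)) => // x Ux.
by rewrite deriveM//; [exact: dfi|exact: dgi].
Qed.

End CkTheory.

(* [from] is a total function, but only its restriction to [cod] matters, and
   likewise for [to] and [dom]. *)
Record chart (R : realType) (n : nat) (M : topologicalType) := Chart {
  dom : set M;
  cod : set 'rV[R]_n;
  to : M -> 'rV[R]_n;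
  from : 'rV[R]_n -> M;
  dom_open : open dom;
  cod_open : open cod;
  to_cod : forall p, dom p -> cod (to p);
  from_dom : forall x, cod x -> dom (from x);
  toK : forall p, dom p -> from (to p) = p;
  fromK : forall x, cod x -> to (from x) = x;
  to_continuous : forall p, dom p -> {for p, continuous to};
  from_continuous : forall x, cod x -> {for x, continuous from} }.

(* The transition map from c to d is smooth, component by component. *)
Definition smooth_transition (R : realType) (n : nat) (M : topologicalType)
    (c d : chart R n M) : Prop :=
  forall i : 'I_n,
    Cinfty_on (cod c `&` from c @^-1` dom d) (fun x => to d (from c x) 0 i).

(* The atlas is not required to be maximal: an atlas and the maximal atlas
   containing it have the same smooth functions. *)
Record manifold (R : realType) (n : nat) := Manifold {
  msort :> topologicalType;
  atlas : set (chart R n msort);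
  manifold_hausdorff : hausdorff_space msort;
  manifold_second_countable : @second_countable msort;
  atlas_cover : forall p : msort, exists2 c, atlas c & dom c p;
  atlas_compatible : forall c d, atlas c -> atlas d -> smooth_transition c d }.

Definition smooth (R : realType) (n : nat) (M : manifold R n) (f : M -> R)
    : Prop :=
  forall c, @atlas R n M c -> Cinfty_on (cod c) (f \o from c).

Section SmoothFunctions.
Context {R : realType} {n : nat} (M : manifold R n).

Definition smooth_pred : pred (M -> R) := fun f => `[< smooth f >].

Record Cinf := MkCinf { Cinf_fun :> M -> R; Cinf_pred : smooth_pred Cinf_fun }.

HB.instance Definition _ := [isSub for Cinf_fun].
HB.instance Definition _ := [Choice of Cinf by <:].

Lemma smooth_cst (a : R) : smooth (fun _ : M => a).
Proof. by move=> c _ k; exact: Ck_cst. Qed.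

Lemma smoothD (f g : M -> R) :
  smooth f -> smooth g -> smooth (fun p => f p + g p).
Proof.
move=> sf sg c Ac k; apply: CkD (sf c Ac k) (sg c Ac k); exact: cod_open.
Qed.

Lemma smoothM (f g : M -> R) :
  smooth f -> smooth g -> smooth (fun p => f p * g p).
Proof.
move=> sf sg c Ac k; apply: CkM (sf c Ac k) (sg c Ac k); exact: cod_open.
Qed.

Lemma smoothN (f : M -> R) : smooth f -> smooth (fun p => - f p).
Proof.
move=> sf; have := smoothM (smooth_cst (-1)) sf; congr smooth.
by apply/funext => p; rewrite mulN1r.
Qed.

Lemma smoothB (f g : M -> R) :
  smooth f -> smooth g -> smooth (fun p => f p - g p).
Proof. by move=> sf /smoothN; exact: smoothD. Qed.

Lemma smooth_subring_closed : subring_closed smooth_pred.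
Proof.
split=> [|f g|f g]; rewrite !unfold_in.
- by apply/asboolP; exact: smooth_cst.
- by move=> /asboolP sf /asboolP sg; apply/asboolP; exact: smoothB.
- by move=> /asboolP sf /asboolP sg; apply/asboolP; exact: smoothM.
Qed.
HB.instance Definition _ :=
  GRing.isSubringClosed.Build (M -> R) smooth_pred smooth_subring_closed.
HB.instance Definition _ := GRing.SubChoice_isSubComPzRing.Build (M -> R)
  smooth_pred Cinf smooth_subring_closed.

Lemma smooth_scale_closed : GRing.scaler_closed smooth_pred.
Proof.
move=> a f; rewrite !unfold_in => /asboolP sf; apply/asboolP.
exact: smoothM (smooth_cst a) sf.
Qed.
HB.instance Definition _ :=
  GRing.isScaleClosed.Build R (M -> R) smooth_pred smooth_scale_closed.
HB.instance Definition _ := [SubZmodule_isSubLmodule of Cinf by <:].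

Lemma Cinf_smooth (f : Cinf) : smooth f.
Proof. exact: asboolW (Cinf_pred f). Qed.

Definition Cinf_of (f : M -> R) (sf : smooth f) : Cinf :=
  MkCinf (asboolT sf : smooth_pred f).

Lemma CinfP (f g : Cinf) : (forall p, f p = g p) -> f = g.
Proof. by move=> fg; apply: val_inj; apply/funext. Qed.

End SmoothFunctions.

Section Tangent.
Context {R : realType} {n : nat} {M : manifold R n}.

(* T_p M is the space of derivations at p of the algebra of smooth functions. *)
Definition point_derivation (p : M) (v : Cinf M -> R) : Prop :=
  (forall (a : R) (f h : Cinf M), v (a *: f + h) = a * v f + v h) /\
  (forall f h : Cinf M, v (f * h) = f p * v h + h p * v f).

Definition derivation_pred (p : M) : pred (Cinf M -> R) :=
  fun v => `[< point_derivation p v >].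

Record tangent (p : M) := MkTangent {
  tan_fun :> Cinf M -> R;
  tan_pred : derivation_pred p tan_fun }.

HB.instance Definition _ p := [isSub for @tan_fun p].
HB.instance Definition _ p := [Choice of tangent p by <:].

Lemma derivation_submod_closed p : submod_closed (derivation_pred p).
Proof.
split=> [|a v w]; rewrite !unfold_in.
  by apply/asboolP; split=> *; rewrite /= !mulr0 addr0.
move=> /asboolP[vl vm] /asboolP[wl wm]; apply/asboolP.
have E f : (a *: v + w) f = a * v f + w f by [].
split=> [b f h|f h]; rewrite !E.
  by rewrite vl wl !mulrDr addrACA (mulrCA a b).
by rewrite vm wm !mulrDr addrACA (mulrCA a (f p)) (mulrCA a (h p)).
Qed.
HB.instance Definition _ p :=
  GRing.isSubmodClosed.Build R (Cinf M -> R) (derivation_pred p)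
    (derivation_submod_closed p).
HB.instance Definition _ p := [SubChoice_isSubLmodule of tangent p by <:].

Definition tangent_of (p : M) (v : Cinf M -> R) (dv : point_derivation p v)
    : tangent p := MkTangent (asboolT dv : derivation_pred p v).

Lemma tangentP (p : M) (v w : tangent p) : (forall f, v f = w f) -> v = w.
Proof. by move=> vw; apply: val_inj; apply/funext. Qed.

End Tangent.

Section VectorFields.
Context {R : realType} {n : nat} {M : manifold R n}.

(* A section of TM is smooth iff it maps smooth functions to smooth functions. *)
Definition smooth_section (X : forall p : M, tangent p) : Prop :=
  forall f : Cinf M, smooth (fun p => X p f).

Record vfield := VField {
  vf_at :> forall p : M, tangent p;
  vf_smooth : smooth_section vf_at }.

HB.instance Definition _ := gen_eqMixin vfield.
HB.instance Definition _ := gen_choiceMixin vfield.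

Lemma vfieldP (X Y : vfield) : (forall p, X p = Y p) -> X = Y.
Proof.
case: X Y => X sX [Y sY] /= XY.
have {}XY : X = Y by exact: functional_extensionality_dep.
by subst Y; congr VField; exact: Prop_irrelevance.
Qed.

Lemma vf_zero_smooth : smooth_section (fun p => 0).
Proof. by move=> f; exact: smooth_cst. Qed.

Lemma vf_opp_smooth (X : vfield) : smooth_section (fun p => - X p).
Proof. by move=> f; apply: smoothN; exact: vf_smooth. Qed.

Lemma vf_add_smooth (X Y : vfield) : smooth_section (fun p => X p + Y p).
Proof. by move=> f; apply: smoothD; exact: vf_smooth. Qed.

Lemma vf_scale_smooth (f : Cinf M) (X : vfield) :
  smooth_section (fun p => f p *: X p).
Proof. by move=> h; apply: smoothM; [exact: Cinf_smooth|exact: vf_smooth]. Qed.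

Definition vf_zero := VField vf_zero_smooth.
Definition vf_opp X := VField (vf_opp_smooth X).
Definition vf_add X Y := VField (vf_add_smooth X Y).
Definition vf_scale f X := VField (vf_scale_smooth f X).

Fact vf_addA : associative vf_add.
Proof. by move=> X Y Z; apply: vfieldP => p /=; rewrite addrA. Qed.
Fact vf_addC : commutative vf_add.
Proof. by move=> X Y; apply: vfieldP => p /=; rewrite addrC. Qed.
Fact vf_add0 : left_id vf_zero vf_add.
Proof. by move=> X; apply: vfieldP => p /=; rewrite add0r. Qed.
Fact vf_addN : left_inverse vf_zero vf_opp vf_add.
Proof. by move=> X; apply: vfieldP => p /=; rewrite addNr. Qed.
HB.instance Definition _ :=
  GRing.isZmodule.Build vfield vf_addA vf_addC vf_add0 vf_addN.

Fact vf_scaleA (f h : Cinf M) X :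
  vf_scale f (vf_scale h X) = vf_scale (f * h) X.
Proof. by apply: vfieldP => p /=; rewrite scalerA. Qed.
Fact vf_scale1 : left_id 1 vf_scale.
Proof. by move=> X; apply: vfieldP => p /=; rewrite scale1r. Qed.
Fact vf_scaleDr : right_distributive vf_scale +%R.
Proof. by move=> f X Y; apply: vfieldP => p /=; rewrite scalerDr. Qed.
Fact vf_scaleDl X : {morph vf_scale^~ X : f h / f + h}.
Proof. by move=> f h; apply: vfieldP => p /=; rewrite scalerDl. Qed.
HB.instance Definition _ :=
  GRing.Zmodule_isLmodule.Build (Cinf M) vfield
    vf_scaleA vf_scale1 vf_scaleDr vf_scaleDl.

(* X f, the derivative of f along X. *)
Definition vf_app (X : vfield) (f : Cinf M) : Cinf M :=
  Cinf_of (vf_smooth X f).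

Lemma bracket_derivation (X Y : vfield) (p : M) :
  point_derivation p (fun f => X p (vf_app Y f) - Y p (vf_app X f)).
Proof.
have L (Z : vfield) q a f h : Z q (a *: f + h) = a * Z q f + Z q h.
  by have [Zl _] := asboolW (tan_pred (Z q)); exact: Zl.
have P (Z : vfield) q f h : Z q (f * h) = f q * Z q h + h q * Z q f.
  by have [_ Zm] := asboolW (tan_pred (Z q)); exact: Zm.
have D (Z : vfield) q f h : Z q (f + h) = Z q f + Z q h.
  by rewrite -[f]scale1r L mul1r scale1r.
have AL (Z : vfield) a f h :
    vf_app Z (a *: f + h) = a *: vf_app Z f + vf_app Z h.
  by apply: CinfP => q; exact: L.
have AP (Z : vfield) f h :
    vf_app Z (f * h) = f * vf_app Z h + h * vf_app Z f.
  by apply: CinfP => q; exact: P.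
split=> [a f h|f h]; first by rewrite !AL !L opprD addrACA mulrBr.
by rewrite !AP !D !P /=; ring.
Qed.

Lemma bracket_smooth (X Y : vfield) :
  smooth_section (fun p => tangent_of (bracket_derivation X Y p)).
Proof. by move=> f; apply: smoothB; exact: vf_smooth. Qed.

Definition bracket (X Y : vfield) : vfield := VField (bracket_smooth X Y).

End VectorFields.
Arguments vfield {R n} M.

Section Tensors.
Context {R : realType} {n : nat} {M : manifold R n}.

(* Tensor fields of type (1,1): fields of endomorphisms of the T_p M; such a
   field is smooth iff it maps smooth vector fields to smooth vector fields.
   Likewise for 1-forms and metrics below. *)
Record endofield := EndoField {
  endo_at :> forall p : M, {linear tangent p -> tangent p};
  endo_smooth : forall X : vfield M,
    smooth_section (fun p => endo_at p (X p)) }.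

Definition endo_app (K : endofield) (X : vfield M) : vfield M :=
  VField (endo_smooth K X).

Record oneform := OneForm {
  form_at :> forall p : M, {linear tangent p -> R};
  form_smooth : forall X : vfield M, smooth (fun p => form_at p (X p)) }.

Definition form_app (w : oneform) (X : vfield M) : Cinf M :=
  Cinf_of (form_smooth w X).

Record riemannian_metric := RiemannianMetric {
  riem_at :> forall p : M, tangent p -> tangent p -> R;
  riem_linear : forall (p : M) (a : R) (u v w : tangent p),
    riem_at (a *: u + v) w = a * riem_at u w + riem_at v w;
  riem_sym : forall (p : M) (v w : tangent p),
    riem_at v w = riem_at w v;
  riem_posdef : forall (p : M) (v : tangent p),
    v != 0 -> 0 < riem_at v v;
  riem_smooth : forall X Y : vfield M,
    smooth (fun p => riem_at (X p) (Y p)) }.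

Definition riem_app (g : riemannian_metric) (X Y : vfield M) : Cinf M :=
  Cinf_of (riem_smooth g X Y).

(* Compatibility with real scalars in Y follows from the Leibniz rule. *)
Record connection := Connection {
  conn_app :> vfield M -> vfield M -> vfield M;
  conn_linear : forall (f : Cinf M) (X Y Z : vfield M),
    conn_app (f *: X + Y) Z = f *: conn_app X Z + conn_app Y Z;
  conn_add : forall X Y Z : vfield M,
    conn_app X (Y + Z) = conn_app X Y + conn_app X Z;
  conn_leibniz : forall (f : Cinf M) (X Y : vfield M),
    conn_app X (f *: Y) = vf_app X f *: Y + f *: conn_app X Y }.

Definition torsion_free (nabla : connection) : Prop :=
  forall X Y : vfield M, nabla X Y - nabla Y X = bracket X Y.

Definition preserves_metric (g : riemannian_metric) (nabla : connection) : Prop :=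
  forall X Y Z : vfield M,
    vf_app X (riem_app g Y Z) =
    riem_app g (nabla X Y) Z + riem_app g Y (nabla X Z).

Definition levi_civita (g : riemannian_metric) (nabla : connection) : Prop :=
  torsion_free nabla /\ preserves_metric g nabla.

(* The covariant derivative (nabla_X K) Y. *)
Definition cov_endo (nabla : connection) (K : endofield) (X Y : vfield M)
    : vfield M :=
  nabla X (endo_app K Y) - endo_app K (nabla X Y).

Definition nijenhuis (K : endofield) (X Y : vfield M) : vfield M :=
  endo_app K (endo_app K (bracket X Y))
  + bracket (endo_app K X) (endo_app K Y)
  - endo_app K (bracket (endo_app K X) Y)
  - endo_app K (bracket X (endo_app K Y)).

Definition endo_integrable (K : endofield) : Prop :=
  forall X Y : vfield M, nijenhuis K X Y = 0.

Record almost_quadratic (a b : R) (phi : endofield) (xi : vfield M)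
    (eta : oneform) : Prop := AlmostQuadratic {
  aq_b : b != 0;
  aq_disc : a ^+ 2 + 4 * b != 0;
  aq_xi_neq0 : forall p, xi p != 0;
  aq_phi_xi : forall p, phi p (xi p) = 0;
  aq_quadratic : forall p (v : tangent p),
    phi p (phi p v) = a *: phi p v + b *: (v - eta p v *: xi p) }.

Lemma aq_eta_xi a b phi xi eta : almost_quadratic a b phi xi eta ->
  forall p, eta p (xi p) = 1.
Proof.
case=> b0 _ xi0 phixi quad p; have := quad p (xi p).
rewrite phixi linear0 scaler0 add0r => /esym/eqP.
rewrite -[X in X - _]scale1r -scalerBl scalerA scaler_eq0 (negPf (xi0 p)) orbF.
by rewrite mulf_eq0 (negPf b0) subr_eq0 => /eqP.
Qed.

Lemma aq_eta_phi a b phi xi eta : almost_quadratic a b phi xi eta ->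
  forall p (v : tangent p), eta p (phi p v) = 0.
Proof.
case=> b0 _ xi0 phixi quad p v; have := quad p (phi p v).
rewrite [in LHS](quad p v) linearD [phi p (a *: _)]linearZ [phi p (b *: _)]linearZ
  linearB [phi p (eta _ _ *: _)]linearZ /= phixi scaler0 subr0.
move=> /addrI /(scalerI b0); rewrite -[X in X = _]subr0 => /addrI.
by move=> /oppr_inj /esym/eqP; rewrite scaler_eq0 (negPf (xi0 p)) orbF => /eqP.
Qed.

(* xi is a unit vector field for g; before g is given ([almost_quadratic]), it
   is only required to vanish nowhere.  The other usual form of compatibility is
   lemma [aqm_compat2]. *)
Record almost_quadratic_metric (a b : R) (g : riemannian_metric) (phi : endofield)
    (xi : vfield M) (eta : oneform) : Prop := AlmostQuadraticMetric {
  aqm_aq : almost_quadratic a b phi xi eta;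
  aqm_unit : forall p, g p (xi p) (xi p) = 1;
  aqm_compat : forall p (v w : tangent p), g p (phi p v) w = g p v (phi p w) }.

Lemma aqm_compat2 a b g phi xi eta :
  almost_quadratic_metric a b g phi xi eta ->
  forall p (v w : tangent p),
    g p (phi p v) (phi p w) = a * g p (phi p v) w
                              + b * (g p v w - eta p v * eta p w).
Proof.
case=> aq unit compat p.
have [b0 _ _ _ quad] := aq.
have gD u v w : g p (u + v) w = g p u w + g p v w.
  by rewrite -[u]scale1r riem_linear mul1r scale1r.
have g0 w : g p 0 w = 0 by apply: (addrI (g p 0 w)); rewrite -gD !addr0.
have gZ c u w : g p (c *: u) w = c * g p u w.
  by rewrite -[c *: u]addr0 riem_linear g0 addr0.
have gB u v w : g p (u - v) w = g p u w - g p v w.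
  by rewrite gD -scaleN1r gZ mulN1r.
have E v w : g p (phi p v) (phi p w) =
    a * g p (phi p v) w + b * (g p v w - eta p v * g p (xi p) w).
  by rewrite -compat quad gD !gZ gB gZ.
suff xiE w : g p (xi p) w = eta p w by move=> v w; rewrite E xiE.
have gr0 u : g p u 0 = 0 by rewrite riem_sym g0.
have := E w (xi p); rewrite compat (aq_phi_xi aq) !(compat, aq_phi_xi aq, gr0).
rewrite linear0 gr0 unit mulr0 add0r mulr1 => /esym/eqP.
by rewrite mulf_eq0 (negPf b0) subr_eq0 riem_sym => /eqP.
Qed.

Record kenmotsu_quadratic (a b : R) (beta : Cinf M) (g : riemannian_metric)
    (nabla : connection) (phi : endofield) (xi : vfield M) (eta : oneform)
    : Prop := KenmotsuQuadratic {
  kq_aqm : almost_quadratic_metric a b g phi xi eta;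
  kq_levi_civita : levi_civita g nabla;
  kq_cov_phi : forall X Y : vfield M,
    cov_endo nabla phi X Y =
    beta *: (riem_app g X (endo_app phi Y) *: xi
             + form_app eta Y *: endo_app phi X) }.

End Tensors.
Arguments endofield {R n} M.
Arguments oneform {R n} M.
Arguments riemannian_metric {R n} M.
Arguments connection {R n} M.

(* Main.v *)
Require Import Defs.
From mathcomp Require Import all_boot all_order all_algebra.
From mathcomp Require Import all_classical all_reals all_analysis.

(** A torsion-free connection lets one replace every bracket in the Nijenhuis
    tensor by covariant derivatives; the terms that differentiate only X or Y
    cancel, and what remains involves only the covariant derivative of the
    endomorphism field ([nijenhuis_cov]):
      N_K(X,Y) = (nabla_KX K)Y - (nabla_KY K)X
                 + K((nabla_Y K)X) - K((nabla_X K)Y).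
    For a Kenmotsu structure each of the four terms is explicit.  The xi parts
    of the first two are beta g(phi X, phi Y) xi and beta g(phi Y, phi X) xi,
    which cancel by symmetry of g; those of the last two are killed by
    phi xi = 0 ([kenmotsu_endo_cov]).  What is left consists of
    beta eta(Y) phi^2 X and beta eta(X) phi^2 Y, each occurring twice with
    opposite signs. *)

Set Implicit Arguments.
Unset Strict Implicit.
Unset Printing Implicit Defensive.

Import GRing.Theory.
Local Open Scope ring_scope.

Section Nijenhuis.
Context {R : realType} {n : nat} {M : manifold R n}.
Implicit Types (K : endofield M) (X Y : vfield M) (nabla : connection M).

Lemma endo_appD K X Y : endo_app K (X + Y) = endo_app K X + endo_app K Y.
Proof. by apply: vfieldP => p /=; rewrite linearD. Qed.

Lemma endo_appN K X : endo_app K (- X) = - endo_app K X.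
Proof. by apply: vfieldP => p /=; rewrite linearN. Qed.

Lemma endo_appZ K (f : Cinf M) X : endo_app K (f *: X) = f *: endo_app K X.
Proof. by apply: vfieldP => p /=; rewrite linearZ. Qed.

Lemma conn_endo_app nabla K X Y :
  nabla X (endo_app K Y) = cov_endo nabla K X Y + endo_app K (nabla X Y).
Proof. by rewrite /cov_endo subrK. Qed.

Lemma riem_appC (g : riemannian_metric M) X Y : riem_app g X Y = riem_app g Y X.
Proof. by apply: CinfP => p /=; exact: riem_sym. Qed.

(** The terms that are not covariant derivatives of [K], namely
    K (nabla_KX Y), K (nabla_KY X) and K^2 (nabla_X Y - nabla_Y X), each
    appear once with each sign. *)
Lemma nijenhuis_cov nabla K X Y : torsion_free nabla ->
  nijenhuis K X Y =
    cov_endo nabla K (endo_app K X) Y - cov_endo nabla K (endo_app K Y) X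
    + endo_app K (cov_endo nabla K Y X) - endo_app K (cov_endo nabla K X Y).
Proof.
move=> tf; rewrite /nijenhuis -!tf !conn_endo_app.
(* [cov_endo] is itself a difference; abstracting it keeps [opprD] from
   splitting it. *)
move: (cov_endo nabla K) => D.
rewrite !(endo_appD, endo_appN) !opprD !opprK.
(* Positions 1 and 11 carry K^2 (nabla_X Y), 2 and 9 carry K^2 (nabla_Y X),
   4 and 7 carry K (nabla_KX Y), and 6 and 12 carry K (nabla_KY X). *)
rewrite (AC (2*(2*2)*(1*2)*(2*1))
            ((1*11)*(2*9)*(4*7)*(6*12)*3*5*8*10)).
by rewrite /= !(subrr, addNr, add0r).
Qed.

(** The part of (nabla_X phi)Y that depends on the metric is a multiple of xi,
    hence lies in the kernel of phi. *)
Lemma kenmotsu_endo_cov (a b : R) (beta : Cinf M) (g : riemannian_metric M)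
    nabla (phi : endofield M) (xi : vfield M) (eta : oneform M) X Y :
  kenmotsu_quadratic a b beta g nabla phi xi eta ->
  endo_app phi (cov_endo nabla phi X Y) =
  beta *: (form_app eta Y *: endo_app phi (endo_app phi X)).
Proof.
case=> [[aq _ _] _ covE].
have phi_xi : endo_app phi xi = 0.
  by apply: vfieldP => p; exact: (aq_phi_xi aq).
by rewrite covE endo_appZ endo_appD !endo_appZ phi_xi scaler0 add0r.
Qed.

End Nijenhuis.

Theorem proposition3p9 (R : realType) (n : nat) (M : manifold R n)
    (a b : R) (beta : Cinf M) (g : riemannian_metric M) (nabla : connection M)
    (phi : endofield M) (xi : vfield M) (eta : oneform M) :
  kenmotsu_quadratic a b beta g nabla phi xi eta ->
  endo_integrable phi.
Proof.
move=> kq X Y; have [_ [tf _] covE] := kq.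
rewrite (nijenhuis_cov _ _ _ tf) !(kenmotsu_endo_cov _ _ kq) !covE.
rewrite (riem_appC g (endo_app phi Y)) !scalerDr opprD addrACA subrr add0r.
by rewrite subrK subrr.
Qed.
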